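(* Let $a=(a_i)_{i\in\mathbb Z}$ be a sequence in $\Bbbk$. For $n\ge1$, in $\mathrm{Sym}^a$, $$S_{n;a}^{[n-1]}=\sum_{k=1}^{n}(-1)^{k-1}\Lambda_{k;a}^{[n-k]}S_{n-k;a}^{[n-1-k]},$$ $$nS_{n;a}^{[n-1]}=\sum_{k=0}^{n-1}S_{k;a}^{[n-1]}\Psi_{n-k;a},$$ $$n\Lambda_{n;a}=\sum_{k=0}^{n-1}(-1)^{n-k-1}\Psi_{n-k;a}^{[k]}\Lambda_{k;a}.$$
   Context: $\Bbbk$ is a field of characteristic zero and $a=(a_i)_{i\in\mathbb Z}$ is a sequence in $\Bbbk$. Put $(t\downarrow a)^k=(t-a_1)\cdots(t-a_k)$, $(t\downarrow a)^0=1$, $(\tau^s a)_i=a_{i+s}$ for $s\in\mathbb Z$, and $\hat a_i=-a_{-i+1}$. $\mathrm{Sym}^a=\Bbbk\langle S_{1;a},S_{2;a},\ldots\rangle$ is the free associative unital $\Bbbk$-algebra on $S_{k;a}$, $k\ge1$. With $t$ a central variable and all expressions expanded as formal power series in $1/t$, put $\sigma^a(t)=\sum_{k\ge0}S_{k;a}/(t\downarrow a)^k$ and $\lambda^{\hat a}(t)=\sum_{k\ge0}\Lambda_{k;a}/(t\downarrow\hat a)^k$ with $S_{0;a}=\Lambda_{0;a}=1$; the elements $\Lambda_{k;a}\in\mathrm{Sym}^a$ are determined by $\lambda^{\hat a}(-t)\sigma^a(t)=\sigma^a(t)\lambda^{\hat a}(-t)=1$. Shifts: for $s\in\mathbb Z$,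 $S_{k;a}^{[s]}$ and $\Lambda_{k;a}^{[s]}$ are defined by $\sum_{k\ge0} S_{k;a}^{[s]}/(t\downarrow\tau^{-s}a)^k=\sum_{k\ge0}S_{k;a}/(t\downarrow a)^k$ and $\sum_{k\ge0}\Lambda_{k;a}^{[s]}/(t\downarrow\tau^{s}\hat a)^k=\sum_{k\ge0}\Lambda_{k;a}/(t\downarrow\hat a)^k$. The $a$-shifted power sums and their shifts are $\Psi_{n;a}=\sum_{k=0}^{n-1}(-1)^k(n-k)\Lambda_{k;a}^{[n-k]}S_{n-k;a}^{[n-k-1]}$ and, for $s\in\mathbb Z$, $\Psi_{n;a}^{[s]}=\sum_{k=0}^{n-1}(-1)^k(n-k)\Lambda_{k;a}^{[n-k+s]}S_{n-k;a}^{[n-k-1+s]}$. *)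

(* Defs.v *)
From HB Require Import structures.
From mathcomp Require Import all_boot all_order all_algebra.
From mathcomp Require Import monalg.

Set Implicit Arguments.
Unset Strict Implicit.
Unset Printing Implicit Defensive.

Import GRing.Theory.
Local Open Scope ring_scope.

(* A formal power series in 1/t with coefficients in A is represented by the
   function m |-> coefficient of t^-m; equality of series is =1. *)
Section Series.
Variable A : nzRingType.
Implicit Types f g h : nat -> A.

Definition sone (m : nat) : A := (m == 0%N)%:R.

Definition smul f g (m : nat) : A := \sum_(j < m.+1) f j * g (m - j)%N.

(* f(t) |-> f(-t) *)
Definition sneg f (m : nat) : A := (-1) ^+ m * f m.

Lemma smul_poly N f g m : (m < N)%N ->
  smul f g m = ((\poly_(i < N) f i) * (\poly_(i < N) g i))`_m.
Proof.
move=> ltmN; rewrite coefM; apply: eq_bigr => j _; rewrite !coef_poly.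
by rewrite (leq_ltn_trans _ ltmN) ?leq_ord // (leq_ltn_trans (leq_subr _ _)).
Qed.

Lemma smulA f g h : smul f (smul g h) =1 smul (smul f g) h.
Proof.
move=> m; pose p u := \poly_(i < m.+1) (u i : A).
transitivity ((p f * (p g * p h))`_m); last rewrite mulrA.
  rewrite coefM; apply: eq_bigr => j _; rewrite (smul_poly (N := m.+1)).
    by rewrite /p coef_poly ltn_ord.
  by rewrite ltnS leq_subr.
rewrite coefM; apply: eq_bigr => j _.
by rewrite (smul_poly (N := m.+1)) // /p (coef_poly _ _ (m - j)) ltnS leq_subr.
Qed.

Lemma smul1s f : smul sone f =1 f.
Proof.
move=> m; rewrite /smul big_ord_recl /sone /= mul1r subn0 big1 ?addr0 //.
by move=> i _; rewrite mul0r.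
Qed.

Lemma smuls1 f : smul f sone =1 f.
Proof.
move=> m; rewrite /smul big_ord_recr /sone /= subnn mulr1 big1 ?add0r //.
by move=> i _; rewrite subn_eq0 leqNgt ltn_ord mulr0.
Qed.

Lemma eq_smul f f' g g' : f =1 f' -> g =1 g' -> smul f g =1 smul f' g'.
Proof. by move=> ef eg m; apply: eq_bigr => j _; rewrite ef eg. Qed.

Lemma eq_sneg f g : f =1 g -> sneg f =1 sneg g.
Proof. by move=> efg m; rewrite /sneg efg. Qed.

Lemma snegK f : sneg (sneg f) =1 f.
Proof.
by move=> m; rewrite /sneg mulrA -exprD addnn -mul2n exprM sqrrN !expr1n mul1r.
Qed.

End Series.

(* Used only to show that the sequences specified by power series identities
   exist; they are then referred to through sval of these existence lemmas. *)
Lemma cov_rec (A : nzRingType) (F : nat -> (nat -> A) -> A) :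
  (forall m c c', (forall k, (k < m)%N -> c k = c' k) -> F m c = F m c') ->
  {c : nat -> A | forall m, c m = F m c}.
Proof.
move=> extF.
pose cs := fix cs m : seq A :=
  if m is m'.+1 then rcons (cs m') (F m' (nth 0 (cs m'))) else [::].
have szcs m : size (cs m) = m by elim: m => //= m IH; rewrite size_rcons IH.
have nthcs m k : (k < m)%N -> nth 0 (cs m) k = nth 0 (cs k.+1) k.
  elim: m => // m IH; rewrite ltnS leq_eqVlt => /orP[/eqP->//|ltkm].
  by rewrite [LHS]/= nth_rcons szcs ltkm IH.
exists (fun m => nth 0 (cs m.+1) m) => m.
rewrite [LHS]/= nth_rcons szcs ltnn eqxx; apply: extF => k ltkm.
exact: nthcs.
Qed.

Section RightInverse.
Variable A : nzRingType.
Implicit Types f g : nat -> A.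

Lemma sinv_right f : f 0%N = 1 ->
  {g | g 0%N = 1 & smul f g =1 sone A}.
Proof.
move=> f0.
pose F m (c : nat -> A) := sone A m - \sum_(j < m) f j.+1 * c (m - j.+1)%N.
have [|g gE] := @cov_rec A F.
  move=> m c c' e; rewrite /F; congr (_ - _); apply: eq_bigr => j _.
  by rewrite e // subnSK ?leq_subr // ltn_subrL; case: (m) j => [[]|].
have gP : smul f g =1 sone A.
  move=> m; rewrite /smul big_ord_recl /= f0 mul1r subn0 gE /F.
  by rewrite addrNK.
exists g => //.
by rewrite gE /F big_ord0 subr0.
Qed.

Lemma sinv f : f 0%N = 1 ->
  {g | smul g f =1 sone A & smul f g =1 sone A}.
Proof.
move=> f0; have [g g0 fg] := sinv_right f0; have [h _ gh] := sinv_right g0.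
exists g => //.
have fh : f =1 h.
  move=> m; rewrite -[LHS]smuls1 -(eq_smul (frefl f) gh) smulA.
  by rewrite (eq_smul fg (frefl h)) smul1s.
by move=> m; rewrite (eq_smul (frefl g) fh).
Qed.

End RightInverse.

Section Expansions.
Variables (K : fieldType) (A : lalgType K).
Implicit Types (a b : int -> K) (c : nat -> A).

Definition tau (s : int) a (i : int) : K := a (i + s).
Definition hat a (i : int) : K := - a (- i + 1).

(* 1/(t - x) = sum_(m >= 0) x^m t^-(m+1) *)
Definition geom (x : K) (m : nat) : K := if m is m'.+1 then x ^+ m' else 0.

Lemma geomP (x : K) (m : nat) : geom x m.+1 - x * geom x m = sone K m.
Proof. by case: m => [|m]; rewrite /= /sone ?mulr0 ?subr0 // -exprS subrr. Qed.

(* 1 / (t \downarrow b)^k *)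
Definition inv_down b (k : nat) : nat -> K :=
  \big[@smul K / sone K]_(1 <= i < k.+1) geom (b i%:Z).

(* sum_(k >= 0) c_k / (t \downarrow b)^k; terms with k > m do not contribute
   to the coefficient of t^-m (see inv_down_gt). *)
Definition expansion b c (m : nat) : A :=
  \sum_(k < m.+1) inv_down b k m *: c k.

Lemma inv_downS b k :
  inv_down b k.+1 =1 smul (inv_down b k) (geom (b k.+1%:Z)).
Proof.
have nilE (r : seq nat) x (G : nat -> nat -> K) :
  \big[@smul K / sone K]_(i <- rcons r x) G i
    =1 smul (\big[@smul K / sone K]_(i <- r) G i) (G x).
  elim: r => [|y r IH] m.
    by rewrite /= big_cons !big_nil smul1s smuls1.
  by rewrite /= !big_cons -smulA; apply: eq_smul.
move=> m; have -> : inv_down b k.+1 =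
    \big[@smul K / sone K]_(i <- rcons (index_iota 1 k.+1) k.+1) geom (b i%:Z).
  rewrite /inv_down /index_iota !subn1 -cats1 [k.+2.-1]/= -[k.+1]addn1 iotaD.
  by rewrite addnC addn1.
exact: nilE.
Qed.

Lemma inv_down_gt b k m : (m < k)%N -> inv_down b k m = 0.
Proof.
elim: k m => // k IH m; rewrite ltnS => lemk; rewrite inv_downS /smul big1 //.
move=> j _; have [ltjk|lekj] := ltnP j k; first by rewrite IH ?mul0r.
have -> : (m - j = 0)%N by apply/eqP; rewrite subn_eq0 (leq_trans lemk).
by rewrite mulr0.
Qed.

Lemma inv_down_diag b k : inv_down b k k = 1.
Proof.
elim: k => [|k IH]; first by rewrite /inv_down big_geq.
rewrite inv_downS /smul big_ord_recr big_ord_recr /= subnn mulr0 addr0.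
rewrite subSnn /= expr0 mulr1 IH big1 ?add0r // => j _.
by rewrite inv_down_gt ?mul0r.
Qed.

Lemma expansion_inj b c c' : expansion b c =1 expansion b c' -> c =1 c'.
Proof.
move=> e m; elim/ltn_ind: m => m IH; have := e m.
rewrite /expansion !big_ord_recr /= inv_down_diag !scale1r.
rewrite (eq_bigr (fun k : 'I_m => inv_down b k m *: c' k)); last first.
  by move=> k _; rewrite IH.
exact: addrI.
Qed.

Lemma expansion_exists b (f : nat -> A) : {c | expansion b c =1 f}.
Proof.
pose F m c := f m - \sum_(k < m) inv_down b k m *: c k.
have [|c cE] := @cov_rec A F.
  move=> m c c' e; rewrite /F; congr (_ + - _).
  by apply: eq_bigr => k _; rewrite e.
exists c => m; rewrite /expansion big_ord_recr /= inv_down_diag scale1r.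
by rewrite [c m]cE addrC subrK.
Qed.

Lemma inverse_expansion_exists b (f : nat -> A) : f 0%N = 1 ->
  {L : nat -> A | L 0%N = 1 /\
     (smul (sneg (expansion b L)) f =1 sone A /\
      smul f (sneg (expansion b L)) =1 sone A)}.
Proof.
move=> f0; have [g gf fg] := sinv f0.
have [L LE] := expansion_exists b (sneg g).
have LK : sneg (expansion b L) =1 g.
  by move=> m; rewrite -[RHS]snegK /sneg LE.
exists L; split; last first.
  split=> m; first by rewrite (eq_smul LK (frefl _)).
  by rewrite (eq_smul (frefl _) LK).
have := fg 0%N; rewrite /smul big_ord1 f0 mul1r -LK /sneg mul1r.
by rewrite /expansion big_ord1 inv_down_diag scale1r.
Qed.

Lemma inverse_expansion_unique b (f L L' : nat -> A) :
  smul (sneg (expansion b L)) f =1 sone A ->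
  smul f (sneg (expansion b L')) =1 sone A -> L =1 L'.
Proof.
set l := sneg _; set l' := sneg _ => lf fl'.
have ll' : l =1 l'.
  move=> m; rewrite -(smuls1 l m) -(eq_smul (frefl l) fl') smulA.
  by rewrite (eq_smul lf (frefl l')) smul1s.
apply: (@expansion_inj b) => m.
rewrite -(snegK (expansion b L) m) -(snegK (expansion b L') m).
exact: (eq_sneg ll').
Qed.

End Expansions.

(* Sym^a: the free associative unital algebra on countably many generators;
   the generator of index i stands for S_{i+1;a}. *)
Definition Sym (K : fieldType) := {malg K[{fmonom nat}]}.

Section SymElements.
Variable K : fieldType.
Implicit Type a : int -> K.

Definition Sgen (k : nat) : Sym K :=
  if k is i.+1 then << fmu i >> else 1.

Definition sigma a : nat -> Sym K := expansion a Sgen.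

Lemma sigma0 a : sigma a 0%N = 1.
Proof. by rewrite /sigma /expansion big_ord1 inv_down_diag scale1r. Qed.

(* lambda^{\hat a}(-t) sigma^a(t) = sigma^a(t) lambda^{\hat a}(-t) = 1 *)
Lemma Lambda_exists a :
  {L : nat -> Sym K | L 0%N = 1 /\
     (smul (sneg (expansion (hat a) L)) (sigma a) =1 sone (Sym K) /\
      smul (sigma a) (sneg (expansion (hat a) L)) =1 sone (Sym K))}.
Proof. exact: inverse_expansion_exists (hat a) (sigma a) (sigma0 a). Qed.

Definition Lambda a : nat -> Sym K := sval (Lambda_exists a).

(* Ssh a s k = S_{k;a}^{[s]} and Lsh a s k = Lambda_{k;a}^{[s]} *)
Definition Ssh a (s : int) : nat -> Sym K :=
  sval (expansion_exists (tau (- s) a) (sigma a)).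

Definition Lsh a (s : int) : nat -> Sym K :=
  sval (expansion_exists (tau s (hat a)) (expansion (hat a) (Lambda a))).

Lemma LambdaP a : Lambda a 0%N = 1 /\
  (smul (sneg (expansion (hat a) (Lambda a))) (sigma a) =1 sone (Sym K) /\
   smul (sigma a) (sneg (expansion (hat a) (Lambda a))) =1 sone (Sym K)).
Proof. exact: svalP (Lambda_exists a). Qed.

Lemma SshP a s : expansion (tau (- s) a) (Ssh a s) =1 expansion a Sgen.
Proof. exact: svalP (expansion_exists (tau (- s) a) (sigma a)). Qed.

Lemma LshP a s :
  expansion (tau s (hat a)) (Lsh a s) =1 expansion (hat a) (Lambda a).
Proof. exact: svalP (expansion_exists (tau s (hat a)) _). Qed.

Definition Psi a (n : nat) : Sym K :=
  \sum_(0 <= k < n) (-1) ^+ k *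
    (Lsh a (n%:Z - k%:Z) k * Ssh a (n%:Z - k%:Z - 1) (n - k)%N) *+ (n - k).

(* Psish a s n = Psi_{n;a}^{[s]} *)
Definition Psish a (s : int) (n : nat) : Sym K :=
  \sum_(0 <= k < n) (-1) ^+ k *
    (Lsh a (n%:Z - k%:Z + s) k * Ssh a (n%:Z - k%:Z - 1 + s) (n - k)%N)
      *+ (n - k).

End SymElements.

(* Main.v *)
Require Import Defs.
From mathcomp Require Import all_boot all_order all_algebra.
From mathcomp Require Import monalg finmap zify.

Set Implicit Arguments.
Unset Strict Implicit.

Import GRing.Theory.
Local Open Scope ring_scope.

(** Why the three identities hold.

    Multiplying sigma(t) = sum_k S_k^[s] / prod_(i = 1-s .. k-s) (t - a_i) by
    the product of the first n-1 factors t - a_i turns the terms with k < n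
    into polynomials and leaves those with k > n of order at least 2 in 1/t.
    So S_n^[s] is, for n >= 1, the coefficient of 1/t in
      sigma(t) * prod_(i = 1-s .. n-1-s) (t - a_i),
    and it depends on the shift only through the window of indices i.  Let
    [f | i, n] stand for the coefficient of 1/t in the product of f(t) and the
    n-1 factors t - a_i, ..., t - a_(i+n-2), or for the constant term of f if
    n = 0; this is ncoef.  Since -t - \hat a_i = -(t - a_(1-i)), the signed
    elements (-1)^k Lambda_k^[s] are such coefficients too, of lambda(-t), with
    the window read downwards:
      S_n^[s] = [sigma | 1-s, n],
      (-1)^n Lambda_n^[s] = [lambda(-t) | 2-s-n, n].

    These coefficients obey a Leibniz rule (ncoef_smul),
      [f g | i, n] = sum_(k = 0 .. n) [f | i, k] [g | i+k, n-k],
    in which the windows of f and g are separated by the single omitted index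
    i+k-1.  Applied to lambda(-t) sigma(t) = sigma(t) lambda(-t) = 1, for which
    all coefficients with n > 0 vanish, it gives two orthogonality relations
    between the S and the signed Lambda, with exactly the shifts of the
    theorem (Lambda_S_orthogonal and S_Lambda_orthogonal).

    The first identity is one of these relations.  The other two follow from
    them in any ring: substituting the definition of Psi gives a sum over
    triples of indices with total n, weighted by the index of the factor S
    that comes from Psi.  In the second identity the sum over the two other
    factors S and Lambda collapses.  In the third one the weight is written as
    (n - j) - k, where j and k are the indices of the two factors Lambda; then
    the sum over the last two factors collapses in the first part, and the sum
    over the first two in the second part. *)

(** * Newton coefficients of a series in 1/t *)

Section NewtonCoefficients.
Variables (K : fieldType) (A : lalgType K).
Implicit Types (a b : int -> K) (c f g h : nat -> A).

(** The product (t - x) f(t) without its term in t.  A multiple of t remains one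
    under further products, so the discarded term never reaches the coefficient
    of 1/t. *)
Definition mul_lin (x : K) f (m : nat) : A := f m.+1 - x *: f m.

(** For n >= 1 this is the coefficient of 1/t in
    f(t) (t - a_i) ... (t - a_(i+n-2)).  The constant term at n = 0 is the
    value that makes the Leibniz rule uniform. *)
Fixpoint ncoef a (i : int) (n : nat) f : A :=
  match n with
  | 0 => f 0%N
  | 1 => f 1%N
  | n'.+1 => ncoef a (i + 1) n' (mul_lin (a i) f)
  end.

Lemma eq_mul_lin x f g : f =1 g -> mul_lin x f =1 mul_lin x g.
Proof. by move=> e m; rewrite /mul_lin !e. Qed.

Arguments ncoef : simpl never.

Lemma ncoefSS a i n f :
  ncoef a i n.+2 f = ncoef a (i + 1) n.+1 (mul_lin (a i) f).
Proof. by []. Qed.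

Lemma eq_ncoef a i n f g : f =1 g -> ncoef a i n f = ncoef a i n g.
Proof.
elim/ltn_ind: n i f g => -[|[|n]] IH i f g e; [exact: e | exact: e|].
by rewrite !ncoefSS; apply: IH => //; apply: eq_mul_lin.
Qed.

Lemma ncoef_tau a (s : int) i n f :
  ncoef (tau s a) i n f = ncoef a (i + s) n f.
Proof.
elim/ltn_ind: n i f => -[|[|n]] IH i f //.
by rewrite !ncoefSS IH // addrAC.
Qed.

Lemma mul_linC x y f : mul_lin x (mul_lin y f) =1 mul_lin y (mul_lin x f).
Proof.
move=> m; rewrite /mul_lin !scalerBr !scalerA [y * x]mulrC.
by rewrite !opprB !addrA addrAC [RHS]addrAC; congr (_ + _); rewrite addrAC.
Qed.

(** The linear factors commute, so a window may also be consumed from its right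
    end; this is what reverses the descending windows of \hat a. *)
Lemma ncoef_last a i n f :
  ncoef a i n.+2 f = ncoef a i n.+1 (mul_lin (a (i + n%:Z)) f).
Proof.
elim: n i f => [|n IH] i f; first by rewrite addr0.
rewrite ncoefSS IH [RHS]ncoefSS; apply: eq_ncoef => m.
by rewrite mul_linC; congr (mul_lin _ (mul_lin (a _) _) _); lia.
Qed.

Lemma ncoef_linear a i n (u : A) f g :
  (forall x v w, v * (x *: w) = x *: (v * w) :> A) ->
  ncoef a i n (fun m => u * f m + g m) = u * ncoef a i n f + ncoef a i n g.
Proof.
move=> scalerC; elim/ltn_ind: n i f g => -[|[|n]] IH i f g //.
rewrite !ncoefSS -IH //; apply: eq_ncoef => m.
rewrite /mul_lin mulrBr scalerC scalerDr opprD !addrA; congr (_ + _).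
by rewrite addrAC.
Qed.

Lemma mul_lin_smul x f g m :
  mul_lin x (smul f g) m = f 0%N * g m.+1 + smul (mul_lin x f) g m.
Proof.
rewrite /mul_lin /smul big_ord_recl subn0 -addrA; congr (_ + _).
rewrite scaler_sumr -sumrB; apply: eq_bigr => j _.
by rewrite mulrBl scalerAl /= /bump subSS.
Qed.

(** Leibniz rule.  One factor is consumed at a time: (t - x) f g equals
    mul_lin x f times g plus f_0 t g, and f_0 t g = f_0 (t - x) g + x f_0 g.
    The term f_0 (t - x) g gives the summand k = 0, in which all factors act
    on g.  The hypothesis says that scalars are central in A. *)
Lemma ncoef_smul a i n f g :
  (forall x v w, v * (x *: w) = x *: (v * w) :> A) ->
  ncoef a i n (smul f g) =
    \sum_(k < n.+1) ncoef a i k f * ncoef a (i + k%:Z) (n - k)%N g.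
Proof.
move=> scalerC; elim/ltn_ind: n i f g => -[|[|n]] IH i f g.
- by rewrite big_ord1 /ncoef /= /smul big_ord1.
- by rewrite !big_ord_recr big_ord0 /ncoef /= /smul !big_ord_recr big_ord0.
rewrite ncoefSS; transitivity (ncoef a (i + 1) n.+1 (fun m =>
  f 0%N * mul_lin (a i) g m
    + (a i *: f 0%N * g m + smul (mul_lin (a i) f) g m))).
  apply: eq_ncoef => m; rewrite mul_lin_smul addrA; congr (_ + _).
  by rewrite /mul_lin mulrBr scalerC scalerAl subrK.
rewrite (ncoef_linear _ _ _ _ (mul_lin (a i) g)
  (fun m => (a i *: f 0%N) * g m + smul (mul_lin (a i) f) g m)) //.
rewrite (ncoef_linear _ _ _ (a i *: f 0%N) g) // IH //.
rewrite big_ord_recl [RHS]big_ord_recl [X in _ = _ + X]big_ord_recl.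
(* The term x f_0 g completes the constant term f_1 - x f_0 of mul_lin x f to
   f_1, the Newton coefficient of f for the summand k = 1. *)
rewrite !subn0 !addr0; congr (_ + _); rewrite addrA -mulrDl.
rewrite -[ncoef _ _ _ (mul_lin _ f)]/(f 1%N - a i *: f 0%N).
rewrite [_ *: _ + _]addrC subrK; congr (_ * _ + _).
apply: eq_bigr => k _; rewrite !lift0 ncoefSS !subSS.
by congr (_ * ncoef _ _ _ _); lia.
Qed.

Lemma ncoef_const a i n f : (forall m, f m.+1 = 0) -> ncoef a i n.+1 f = 0.
Proof.
elim: n i f => [|n IH] i f f0; first exact: f0.
by rewrite ncoefSS IH // => m; rewrite /mul_lin !f0 scaler0 subrr.
Qed.

Lemma ncoefN a i n f : ncoef a i n (fun m => - f m) = - ncoef a i n f.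
Proof.
elim/ltn_ind: n i f => -[|[|n]] IH i f //.
rewrite !ncoefSS -IH //; apply: eq_ncoef => m.
by rewrite /mul_lin scalerN opprD.
Qed.

Lemma mul_lin_sneg x f m :
  mul_lin x (sneg f) m = - sneg (mul_lin (- x) f) m.
Proof.
rewrite /mul_lin /sneg exprS mulN1r mulNr mulrBr scaleNr mulrN !opprK opprD.
by congr (_ - _); rewrite -signr_odd; case: odd;
  rewrite ?mulN1r ?mul1r ?scalerN.
Qed.

(** Under t |-> -t each factor t - \hat a_j becomes -(t - a_(1-j)), and the
    window \hat a_i, ..., \hat a_(i+n-2) is read backwards in a, from
    a_(3-i-n) to a_(1-i).  The n-1 factors and 1/t itself contribute the
    sign (-1)^n. *)
Lemma ncoef_hat a i n f :
  (-1) ^+ n * ncoef (hat a) i n f = ncoef a (3 - i - n%:Z) n (sneg f).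
Proof.
elim: n i f => [|[|n] IH] i f //.
rewrite ncoefSS exprS mulN1r mulNr IH ncoef_last.
have -> : 3 - i - n.+2%:Z + n%:Z = - i + 1 by lia.
have -> : 3 - (i + 1) - n.+1%:Z = 3 - i - n.+2%:Z by lia.
by rewrite -ncoefN; apply: eq_ncoef => m; rewrite mul_lin_sneg.
Qed.

Lemma mul_lin_inv_down b k m :
  inv_down b k.+1 m.+1 - b 1 * inv_down b k.+1 m = inv_down (tau 1 b) k m.
Proof.
rewrite {1 2}/inv_down big_ltn // big_add1 /=.
set h := \big[_/_]_(1 <= _ < _) _.
have <- : h = inv_down (tau 1 b) k.
  by apply: eq_bigr => i _; rewrite /tau -addn1 PoszD.
rewrite /smul big_ord_recl subn0 mul0r add0r mulr_sumr -sumrB.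
rewrite -[RHS](smul1s h); apply: eq_bigr => j _.
by rewrite -(geomP (b 1)) mulrBl mulrA /= /bump subSS.
Qed.

(** Multiplication by the first factor shifts the coefficients of an expansion.
    Of the product (t - b_1) c_0 only - b_1 c_0 is kept by mul_lin. *)
Lemma mul_lin_expansion b c m :
  mul_lin (b 1) (expansion b c) m =
    expansion (tau 1 b)
      (fun k => if k is k'.+1 then c k'.+2 else c 1%N - b 1 *: c 0%N) m.
Proof.
have widen : expansion b c m = \sum_(k < m.+2) inv_down b k m *: c k.
  by rewrite [RHS]big_ord_recr /= inv_down_gt // scale0r addr0.
rewrite /mul_lin widen /expansion scaler_sumr -sumrB.
under eq_bigr => k _ do rewrite scalerA -scalerBl.
rewrite big_ord_recl big_ord_recl [RHS]big_ord_recl addrA; congr (_ + _).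
  rewrite mul_lin_inv_down /inv_down !big_geq // scalerBr addrC scalerA.
  by rewrite /sone /= sub0r scaleNr [b 1 * _]mulrC.
by apply: eq_bigr => k _; rewrite !lift0 mul_lin_inv_down.
Qed.

(** Each consumed factor cancels the first denominator, so after n-1 of them c_n
    is the coefficient of 1/t. *)
Lemma ncoef_expansion b c n : ncoef b 1 n (expansion b c) = c n.
Proof.
elim/ltn_ind: n b c => -[|[|n]] IH b c.
- by rewrite /ncoef /expansion big_ord1 inv_down_diag scale1r.
- rewrite /ncoef /expansion !big_ord_recr big_ord0 /= inv_down_diag scale1r.
  by rewrite /inv_down big_geq // scale0r !add0r.
rewrite ncoefSS -ncoef_tau (eq_ncoef _ _ _ (mul_lin_expansion b c)).
by rewrite IH.
Qed.

Lemma expansion_tau_ncoef b s c f n :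
  expansion (tau s b) c =1 f -> c n = ncoef b (1 + s) n f.
Proof.
by move=> e; rewrite -ncoef_tau -(eq_ncoef _ _ _ e) ncoef_expansion.
Qed.

End NewtonCoefficients.

(** * Sums over a triangle of indices *)

Lemma sum_triangle (V : nmodType) n (F : nat -> nat -> V) :
  \sum_(k < n.+1) \sum_(j < (n - k).+1) F k j =
    \sum_(j < n.+1) \sum_(k < (n - j).+1) F k j.
Proof.
have widen (G : nat -> V) k : \sum_(j < (n - k).+1) G j =
    \sum_(j < n.+1 | (j < (n - k).+1)%N) G j.
  by rewrite -big_ord_widen // ltnS leq_subr.
under eq_bigr => k _ do rewrite widen.
under [RHS]eq_bigr => j _ do rewrite (widen (F^~ j)).
rewrite (exchange_big_dep xpredT) //=.
apply: eq_bigr => j _; apply: eq_bigl => k.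
by have := ltn_ord k; have := ltn_ord j; lia.
Qed.

(** The outer index l of the result is n - k - j, the part of n left over by k
    and j. *)
Lemma sum_triangle_rev (V : nmodType) n (F : nat -> nat -> V) :
  \sum_(k < n.+1) \sum_(j < (n - k).+1) F k j =
    \sum_(l < n.+1) \sum_(k < (n - l).+1) F k (n - l - k)%N.
Proof.
rewrite -(sum_triangle n (fun k l => F k (n - l - k)%N)).
apply: eq_bigr => k _; rewrite (reindex_inj rev_ord_inj).
by apply: eq_bigr => j _ /=; rewrite subSS subnAC.
Qed.

(** * Newton identities from orthogonality *)

(** S and L model the families S_k^[s] and (-1)^k Lambda_k^[s]; absorbing the
    sign into L removes all signs from the identities. *)
Section NewtonIdentities.
Variables (A : nzRingType) (S L : int -> nat -> A).
Hypothesis S0 : forall s, S s 0 = 1.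
Hypothesis L0 : forall s, L s 0 = 1.
Hypothesis LS : forall s n,
  \sum_(k < n.+1) L (n%:Z - k%:Z + s) k * S (n%:Z - k%:Z - 1 + s) (n - k)%N
    = (n == 0%N)%:R.
Hypothesis SL : forall s n,
  \sum_(k < n.+1) S (n%:Z - 1 + s) k * L s (n - k)%N = (n == 0%N)%:R.

Definition psum (s : int) (n : nat) : A :=
  \sum_(k < n)
    (L (n%:Z - k%:Z + s) k * S (n%:Z - k%:Z - 1 + s) (n - k)%N) *+ (n - k).

Lemma psum_widen s n : psum s n = \sum_(k < n.+1)
  (L (n%:Z - k%:Z + s) k * S (n%:Z - k%:Z - 1 + s) (n - k)%N) *+ (n - k).
Proof. by rewrite [RHS]big_ord_recr /= subnn mulr0n addr0. Qed.

Lemma psum0 s : psum s 0 = 0.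
Proof. exact: big_ord0. Qed.

(** In the sum of S_k L_j S_l with weight l and k + j + l = n, the sum over k
    and j at fixed l is an instance of SL with shift l, so only l = n stays. *)
Lemma newton_complete n :
  S (n%:Z - 1) n *+ n = \sum_(k < n) S (n%:Z - 1) k * psum 0 (n - k).
Proof.
pose F k j := (S (n%:Z - 1) k * (L ((n - k)%N%:Z - j%:Z) j
      * S ((n - k)%N%:Z - j%:Z - 1) (n - k - j)%N)) *+ (n - k - j).
transitivity (\sum_(k < n.+1) \sum_(j < (n - k).+1) F k j); last first.
  transitivity (\sum_(k < n.+1) S (n%:Z - 1) k * psum 0 (n - k)).
    apply: eq_bigr => k _; rewrite psum_widen mulr_sumr.
    by apply: eq_bigr => j _; rewrite /F -mulrnAr !addr0.
  by rewrite big_ord_recr /= subnn psum0 mulr0 addr0.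
rewrite sum_triangle_rev big_ord_recr /=.
rewrite [X in _ = X + _]big1 ?add0r => [|l _].
  by rewrite subnn big_ord1 /F !subn0 L0 S0 !mul1r subr0.
transitivity ((\sum_(k < (n - l).+1) S ((n - l)%N%:Z - 1 + l%:Z) k
   * L l%:Z (n - l - k)%N) * S (l%:Z - 1) l *+ l).
  rewrite mulr_suml -sumrMnl; apply: eq_bigr => k _; rewrite /F -mulrA.
  have ltkn := ltn_ord k; have ltln := ltn_ord l.
  have -> : (n - k - (n - l - k))%N = l by lia.
  by congr (S _ _ * (L _ _ * S _ _) *+ _); lia.
by rewrite SL subn_eq0 leqNgt ltn_ord mul0r mul0rn.
Qed.

(** In the sum of L_j S_l L_k with weight l = (n - j) - k, the weight n - j goes
    with SL at fixed j, whose only nonzero value, at j = n, has weight 0; the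
    weight k goes with LS at fixed k, where only k = n stays. *)
Lemma newton_elementary n :
  - L 0 n *+ n = \sum_(k < n) psum k%:Z (n - k) * L 0 k.
Proof.
pose T j k := L (n%:Z - j%:Z) j * S (n%:Z - j%:Z - 1) (n - j - k)%N * L 0 k.
have sumTk (j : 'I_n.+1) : \sum_(k < (n - j).+1) T j k =
    L (n%:Z - j%:Z) j * ((n - j)%N == 0%N)%:R.
  rewrite -(SL 0) (reindex_inj rev_ord_inj) mulr_sumr.
  have ltjn := ltn_ord j; apply: eq_bigr => k _.
  rewrite /T /= -mulrA; have ltkn := ltn_ord k.
  by congr (_ * (S _ _ * L _ _)); lia.
have sumTj (k : 'I_n.+1) : \sum_(j < (n - k).+1) T j k =
    ((n - k)%N == 0%N)%:R * L 0 k.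
  rewrite -(LS k%:Z) mulr_suml.
  have ltkn := ltn_ord k; apply: eq_bigr => j _; have ltjn := ltn_ord j.
  by congr (L _ _ * S _ _ * _); lia.
transitivity (\sum_(k < n.+1) \sum_(j < (n - k).+1) T j k *+ (n - j)
    - \sum_(k < n.+1) \sum_(j < (n - k).+1) T j k *+ k); last first.
  transitivity (\sum_(k < n.+1) psum k%:Z (n - k) * L 0 k).
    rewrite -sumrB; apply: eq_bigr => k _; rewrite -sumrB psum_widen mulr_suml.
    apply: eq_bigr => j _; have ltjn := ltn_ord j; have ltkn := ltn_ord k.
    rewrite -mulrnBr; last by lia.
    rewrite mulrnAl /T; have -> : (n - j - k = n - k - j)%N by lia.
    by congr (L _ _ * S _ _ * _ *+ _); lia.
  by rewrite big_ord_recr /= subnn psum0 mul0r addr0.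
rewrite (sum_triangle n (fun k j => T j k *+ (n - j))).
rewrite [X in X - _]big1 => [|j _]; last first.
  rewrite sumrMnl sumTk; case: (n - j)%N => [|l]; first by rewrite mulr0n.
  by rewrite mulr0 mul0rn.
rewrite big_ord_recr /= sumrMnl (sumTj ord_max) subnn mul1r.
rewrite big1 => [|k _]; first by rewrite !add0r mulNrn.
rewrite sumrMnl (sumTj (widen_ord (leqnSn n) k)) /= subn_eq0 leqNgt ltn_ord.
by rewrite mul0r mul0rn.
Qed.

End NewtonIdentities.

(** * Duality between S and Lambda *)

Section Duality.
Variable K : fieldType.
Implicit Type a : int -> K.

(** Scalars are central although the generators of Sym do not commute. *)
Lemma Sym_scalerAr (x : K) (u v : Sym K) : u * (x *: v) = x *: (u * v).
Proof.
apply/malgP => k.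
rewrite (mcoeffMlw _ (fsubset_refl _) (msuppZ_le _ _)) mcoeffZ mcoeffMl.
rewrite mulr_sumr; apply: eq_bigr => k1 _.
rewrite mulr_sumr; apply: eq_bigr => k2 _.
by rewrite mcoeffZ mulrCA mulrnAr.
Qed.

Definition SLambda a (s : int) (k : nat) : Sym K := (-1) ^+ k * Lsh a s k.

(** The series lambda(-t), inverse to sigma(t). *)
Definition lambda_neg a : nat -> Sym K := sneg (expansion (hat a) (Lambda a)).

Lemma Ssh_ncoef a s k : Ssh a s k = ncoef a (1 - s) k (sigma a).
Proof. exact: expansion_tau_ncoef (SshP a s). Qed.

Lemma SLambda_ncoef a s k :
  SLambda a s k = ncoef a (2 - s - k%:Z) k (lambda_neg a).
Proof.
rewrite /SLambda (expansion_tau_ncoef _ (LshP a s)) ncoef_hat.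
by congr (ncoef _ _ _ _); lia.
Qed.

Lemma Lsh0 a k : Lsh a 0 k = Lambda a k.
Proof.
by rewrite (expansion_tau_ncoef _ (LshP a 0)) addr0 ncoef_expansion.
Qed.

Lemma ncoef_sone a i n : ncoef a i n (sone (Sym K)) = (n == 0%N)%:R.
Proof. by case: n => // n; rewrite ncoef_const. Qed.

(** Leibniz rule for lambda(-t) sigma(t) = 1 at the window start 2-s-n: in the
    summand k, Lambda is read from 2-s-n and S from 2-s-n+k, which forces the
    shifts n-k+s and n-k-1+s. *)
Lemma Lambda_S_orthogonal a s n :
  \sum_(k < n.+1) SLambda a (n%:Z - k%:Z + s) k
      * Ssh a (n%:Z - k%:Z - 1 + s) (n - k)%N = (n == 0%N)%:R.
Proof.
have [_ [LS _]] := LambdaP a.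
rewrite -(ncoef_sone a (2 - s - n%:Z)) -(eq_ncoef _ _ _ LS)
  (ncoef_smul _ _ _ _ _ Sym_scalerAr).
apply: eq_bigr => k _; rewrite SLambda_ncoef Ssh_ncoef.
by congr (ncoef _ _ _ _ * ncoef _ _ _ _); lia.
Qed.

(** Leibniz rule for sigma(t) lambda(-t) = 1 at the same window start; S is now
    read first, so both shifts are independent of k. *)
Lemma S_Lambda_orthogonal a s n :
  \sum_(k < n.+1) Ssh a (n%:Z - 1 + s) k * SLambda a s (n - k)%N =
    (n == 0%N)%:R.
Proof.
have [_ [_ SL]] := LambdaP a.
rewrite -(ncoef_sone a (2 - s - n%:Z)) -(eq_ncoef _ _ _ SL)
  (ncoef_smul _ _ _ _ _ Sym_scalerAr).
apply: eq_bigr => k _; rewrite SLambda_ncoef Ssh_ncoef.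
by congr (ncoef _ _ _ _ * ncoef _ _ _ _); have := ltn_ord k; lia.
Qed.

Lemma Ssh_0 a s : Ssh a s 0 = 1.
Proof. by rewrite Ssh_ncoef; apply: sigma0. Qed.

Lemma SLambda_0 a s : SLambda a s 0 = 1.
Proof.
rewrite SLambda_ncoef /ncoef /lambda_neg /sneg mul1r /expansion big_ord1.
by rewrite inv_down_diag scale1r (proj1 (LambdaP a)).
Qed.

Lemma Psish_psum a s n : Psish a s n = psum (Ssh a) (SLambda a) s n.
Proof.
rewrite /Psish big_mkord.
by apply: eq_bigr => k _; rewrite mulrA.
Qed.

Lemma Psi_psum a n : Psi a n = psum (Ssh a) (SLambda a) 0 n.
Proof. by rewrite -Psish_psum; apply: eq_bigr => k _; rewrite !addr0. Qed.

Lemma Ssh_recurrence a n : (0 < n)%N ->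
  Ssh a (n%:Z - 1) n =
    \sum_(1 <= k < n.+1) (-1) ^+ k.-1 *
      (Lsh a (n%:Z - k%:Z) k * Ssh a (n%:Z - 1 - k%:Z) (n - k)%N).
Proof.
move=> n_gt0; have := Lambda_S_orthogonal a 0 n; rewrite eqn0Ngt n_gt0 /=.
rewrite big_ord_recl SLambda_0 mul1r subr0 addr0 subn0 => /eqP.
rewrite addr_eq0 => /eqP ->.
rewrite -sumrN big_add1 big_mkord; apply: eq_bigr => k _.
rewrite lift0 /SLambda exprS mulN1r !mulNr opprK -mulrA.
by rewrite !addr0 -pred_Sn [n%:Z - 1 - _]addrAC.
Qed.

Lemma Ssh_Psi_sum a n :
  Ssh a (n%:Z - 1) n *+ n =
    \sum_(0 <= k < n) Ssh a (n%:Z - 1) k * Psi a (n - k)%N.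
Proof.
rewrite (newton_complete (Ssh_0 a) (SLambda_0 a) (S_Lambda_orthogonal a)).
rewrite big_mkord.
by apply: eq_bigr => k _; rewrite Psi_psum.
Qed.

Lemma Psish_Lambda_sum a n :
  Lambda a n *+ n =
    \sum_(0 <= k < n) (-1) ^+ (n - k - 1)%N *
      (Psish a k%:Z (n - k)%N * Lambda a k).
Proof.
case: n => [|n]; first by rewrite big_geq.
have SLambda0 k : SLambda a 0 k = (-1) ^+ k * Lambda a k.
  by rewrite /SLambda Lsh0.
have -> : Lambda a n.+1 *+ n.+1 = (-1) ^+ n * (- SLambda a 0 n.+1 *+ n.+1).
  by rewrite SLambda0 exprS mulN1r mulNr opprK -mulrnAr signrMK.
rewrite (newton_elementary (Lambda_S_orthogonal a) (S_Lambda_orthogonal a)).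
rewrite big_mkord mulr_sumr.
apply: eq_bigr => k _; rewrite Psish_psum SLambda0.
rewrite [psum _ _ _ _ * (_ * _)]mulrA commr_sign -(mulrA _ _ (Lambda a k)).
rewrite [LHS]mulrA -exprD.
have ltkn := ltn_ord k; have -> : (n + k = (n.+1 - k - 1) + k * 2)%N by lia.
by rewrite exprD exprM sqrr_sign mulr1.
Qed.

End Duality.

Unset Implicit Arguments.

Theorem lemma38 (K : fieldType) (charK : [pchar K] =i pred0)
    (a : int -> K) (n : nat) (n_ge1 : (1 <= n)%N) :
  [/\ Ssh a (n%:Z - 1) n =
        \sum_(1 <= k < n.+1) (-1) ^+ k.-1 *
          (Lsh a (n%:Z - k%:Z) k * Ssh a (n%:Z - 1 - k%:Z) (n - k)%N),
      Ssh a (n%:Z - 1) n *+ n =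
        \sum_(0 <= k < n) Ssh a (n%:Z - 1) k * Psi a (n - k)%N
    & Lambda a n *+ n =
        \sum_(0 <= k < n) (-1) ^+ (n - k - 1)%N *
          (Psish a k%:Z (n - k)%N * Lambda a k)].
Proof.
split; [exact: Ssh_recurrence | exact: Ssh_Psi_sum | exact: Psish_Lambda_sum].
Qed.
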